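(* There exists an infinite measure preserving, recurrent, and ergodic $\mathbb Z^2$ action $(X,\mu,\{T^{\vec n}\}_{\vec n\in\mathbb Z^2})$ on a $\sigma$-finite Lebesgue space with the property that for every non-zero $\vec n\in\mathbb Z^2$ the $\mathbb Z$ action $(X,\mu,\{T^{k\vec n}\}_{k\in\mathbb Z})$ is not recurrent.
   Context: An infinite measure preserving action of a countable group $G$ on $(X,\mu)$ is an action by measurable, $\mu$-preserving invertible maps $T^\gamma$, $\gamma\in G$, where $\mu(X)=\infty$. For $G=\mathbb Z$ or $G=\mathbb Z^2$, a measure preserving action $(X,\mu,\{T^\gamma\}_{\gamma\in G})$ is recurrent if for every measurable set $A$ with $\mu(A)>0$ there exists $\gamma\in G$, $\gamma\neq 0$, such that $\mu(A\cap T^{\gamma}A)>0$. *)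

(* Defs.v *)
From HB Require Import structures.
From mathcomp Require Import all_boot all_order all_algebra.
From mathcomp Require Import all_classical all_reals all_analysis.
From mathcomp Require Import measurable_realfun.

Set Implicit Arguments.
Unset Strict Implicit.
Unset Printing Implicit Defensive.
Import Order.TTheory GRing.Theory Num.Theory.
Local Open Scope classical_set_scope.
Local Open Scope ring_scope.
Local Open Scope ereal_scope.

(* Lebesgue measurable (not only Borel) subsets of the line: the sigma-algebra
   of the sets B `|` N with B Borel and N negligible. *)
Definition lebesgue_measurable {R : realType} : set (set R) :=
  (completed_algebra_gen (@lebesgue_measure R)).-sigma.-measurable.

(* Lebesgue space in the sense of Rokhlin: a complete measure space which is
   isomorphic mod 0 to the disjoint union of an interval (bounded or not) with
   Lebesgue measure and of countably many point masses. Here N and M are the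
   discarded null sets of X and of the interval, D is the set of atoms, and phi
   identifies the rest of X with the rest of the interval. On Lebesgue
   measurable sets completed_lebesgue_measure is the Lebesgue measure. *)
Definition lebesgue_space (R : realType) d (X : measurableType d)
    (mu : {measure set X -> \bar R}) : Prop :=
  measure_is_complete mu /\
  exists (N D : set X) (I : interval R) (M : set R) (phi : X -> R),
    [/\ mu.-negligible N,
        countable D /\
          (forall x, D x -> measurable [set x] /\ 0 < mu [set x]),
        (@lebesgue_measure R).-negligible M,
        set_bij (~` (N `|` D)) ([set` I] `\` M) phi
      & forall A : set X, A `<=` ~` (N `|` D) ->
          (measurable A <-> lebesgue_measurable (phi @` A)) /\
          (measurable A -> mu A = completed_lebesgue_measure (phi @` A))].

(* Actions of abelian groups, in additive notation; each T g is invertible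
   with inverse T (- g). *)
Definition measure_preserving_action (G : zmodType) (R : realType) d
    (X : measurableType d) (mu : {measure set X -> \bar R})
    (T : G -> X -> X) : Prop :=
  [/\ forall x, T 0%R x = x,
      forall g h x, T (g + h)%R x = T g (T h x),
      forall g, measurable_fun setT (T g)
    & forall g (A : set X), measurable A -> mu (T g @^-1` A) = mu A].

Definition recurrent (G : zmodType) (R : realType) d (X : measurableType d)
    (mu : {measure set X -> \bar R}) (T : G -> X -> X) : Prop :=
  forall A : set X, measurable A -> 0 < mu A ->
    exists g : G, g != 0%R /\ 0 < mu (A `&` T g @` A).

Definition ergodic (G : zmodType) (R : realType) d (X : measurableType d)
    (mu : {measure set X -> \bar R}) (T : G -> X -> X) : Prop :=
  forall A : set X, measurable A -> (forall g : G, T g @` A = A) ->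
    mu A = 0 \/ mu (~` A) = 0.

(* Main.v *)
Require Import Defs.
From mathcomp Require Import all_boot all_order all_algebra.
From mathcomp Require Import all_classical all_reals all_analysis.
From mathcomp Require Import lra ring zify measurable_realfun.

(* [int * int] acts on the line, with the completed Lebesgue measure, by
   T (m, n) x = x + m + n * sqrt 2. Each nonzero (m, n) acts as a nonzero
   translation, so a small interval around 0 is disjoint from all its iterates.
   The group of all these translations is dense, and by the Lebesgue density
   theorem any two sets of positive measure overlap, in positive measure, after
   some nonzero translation of the group: with equal sets this is recurrence,
   with an invariant set and its complement it is ergodicity. *)

Import Order.TTheory GRing.Theory Num.Theory.
Import numFieldNormedType.Exports.

Local Open Scope classical_set_scope.
Local Open Scope ring_scope.
Local Open Scope ereal_scope.

(** * Translation invariance of Lebesgue outer measure and of measurability *)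

Lemma lebesgue_measure_le {R : realType} (A B : set R) :
  A `<=` B -> lebesgue_measure A <= lebesgue_measure B.
Proof. exact: (le_outer_measure (wlength idfun)^*%mu). Qed.

Lemma shift_preimage_itvoc {R : realType} (t a b : R) :
  (fun x => x + t)%R @^-1` `]a, b] = `](a - t)%R, (b - t)%R]%classic.
Proof.
by apply/seteqP; split => x; rewrite /= !in_itv/= ltrBlDr lerBrDr.
Qed.

Lemma measurable_shift {R : realType} (t : R) :
  measurable_fun setT
    (fun x : measurableTypeR R => (x + t)%R : measurableTypeR R).
Proof.
exact: (measurable_funD (@measurable_id _ _ _) (@measurable_cst _ _ _ _ _ t)).
Qed.

Lemma lebesgue_measure_shift_measurable {R : realType} (t : R) (A : set R) :
  measurable A ->
  lebesgue_measure ((fun x => x + t)%R @^-1` A) = lebesgue_measure A.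
Proof.
move=> mA; have mt := @measurable_shift R t.
pose nu := pushforward (@lebesgue_measure R)
  (fun x : measurableTypeR R => (x + t)%R : measurableTypeR R).
(* By uniqueness it is enough to compare [nu] with Lebesgue measure on half-open intervals. *)
have := @lebesgue_measure_unique R nu _ A mA.
move=> -> //= _ [[a b] _ <-].
rewrite /= /nu /pushforward shift_preimage_itvoc !lebesgue_measure_itv/=.
rewrite !lte_fin ltrD2r; case: ifP => // _; congr (_ %:E); ring.
Qed.

(* Both sides are outer measures here: [A] is arbitrary. *)
Lemma lebesgue_measure_shift {R : realType} (t : R) (A : set R) :
  lebesgue_measure ((fun x => x + t)%R @^-1` A) = lebesgue_measure A.
Proof.
(* One inequality, for all sets and shifts, suffices: the shift by [- t] gives the converse. An open
   [U] containing [B], of measure at most [e] larger, reduces it to the measurable case. *)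
have le B s :
  lebesgue_measure ((fun x => x + s)%R @^-1` B) <= lebesgue_measure B.
  apply/lee_addgt0Pr => e e0.
  have [U [oU BU UB]] := outer_measure_open_le B e0; refine (le_trans _ UB).
  rewrite -(lebesgue_measure_shift_measurable s U); last exact: open_measurable.
  by apply: lebesgue_measure_le => x; exact: BU.
apply/eqP; rewrite eq_le le /=.
rewrite [leLHS](_ : _ = lebesgue_measure
  ((fun x => x - t)%R @^-1` ((fun x => x + t)%R @^-1` A))); first exact: le.
by congr lebesgue_measure; apply/seteqP; split => x /=; rewrite subrK.
Qed.

(** Carathéodory's criterion involves only the outer measure, which is invariant on all sets; so
    testing the shifted set on [X] amounts to testing [A] on the translate [Y] of [X]. *)
Lemma caratheodory_shift {R : realType} (t : R) (A : set R) :
  (wlength (@idfun R))^*%mu.-cara.-measurable A ->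
  (wlength (@idfun R))^*%mu.-cara.-measurable ((fun x => x + t)%R @^-1` A).
Proof.
move=> mA; suff : caratheodory_measurable (wlength (@idfun R))^*%mu
  ((fun x => x + t)%R @^-1` A) by [].
have {}mA : caratheodory_measurable (wlength (@idfun R))^*%mu A by exact: mA.
move=> X; pose Y := (fun x => x - t)%R @^-1` X.
have XY : X = (fun x => x + t)%R @^-1` Y.
  by apply/seteqP; split => x; rewrite /Y/= addrK.
rewrite XY -[(_ `&` _)]/((fun x => x + t)%R @^-1` (Y `&` A)).
rewrite -[(_ `&` ~` _)]/((fun x => x + t)%R @^-1` (Y `&` ~` A)).
have inv B : (wlength idfun)^*%mu ((fun x => x + t)%R @^-1` B) =
  (wlength (@idfun R))^*%mu B by exact: lebesgue_measure_shift.
by rewrite !inv; exact: mA.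
Qed.

(** Brings sets of the completed sigma-algebra down to Borel sets, to which the density argument
    applies: write [A] as a Borel set plus a negligible one, and drop the latter. *)
Lemma caratheodory_sub_borel {R : realType} (A : set R) :
  (wlength (@idfun R))^*%mu.-cara.-measurable A ->
  exists B : set R, [/\ measurable B, B `<=` A &
    lebesgue_measure A <= lebesgue_measure B].
Proof.
rewrite -completed_caratheodory_measurable g_sigma_completed_algebra_genE.
move=> [B mB [N /negligible_outer_measure N0 <-]].
exists B; split => //.
apply: le_trans (outer_measureU2 (wlength idfun)^*%mu B N) _.
by rewrite [X in _ + X]N0 adde0.
Qed.

(** * Density points and overlapping translates *)

Lemma density_point {R : realType} (A : set R) :
  measurable A -> 0 < lebesgue_measure A ->
  exists x, \forall r \near 0^'+,
    ((3 / 2 * r)%R)%:E < lebesgue_measure (A `&` ball x r).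
Proof.
move=> mA A0.
have [N [mN N0 AN]] := lebesgue_density mA.
have [x [Ax Nx]] : exists x, A x /\ ~ N x.
  apply: contrapT => /forallNP H.
  have : lebesgue_measure A <= lebesgue_measure N.
    by apply: lebesgue_measure_le => x Ax; apply: contrapT => Nx; exact: (H x).
  by rewrite [X in _ <= X]N0 leNgt A0.
exists x.
have /fine_cvgP[_] : lebesgue_measure (A `&` ball x r) *
    (lebesgue_measure (ball x r))^-1 @[r --> 0^'+] --> 1%:E.
  move/subsetCl : AN => /(_ x Nx) /=.
  by rewrite indicE mem_set.
(* The density at [x] is 1, so it eventually exceeds 3/4; the ball has length 2r, whence the bound
   3r/2. *)
move/cvgr_gt => /(_ (3 / 4)%R) H.
near=> r.
have r0 : (0 < r)%R by [].
have : (3 / 4 < fine (lebesgue_measure (A `&` ball x r) *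
    (lebesgue_measure (ball x r))^-1))%R.
  by near: r; apply: H; lra.
have : lebesgue_measure (A `&` ball x r) <= lebesgue_measure (ball x r).
  by apply: lebesgue_measure_le => ? [].
rewrite (lebesgue_measure_ball _ (ltW r0)) inver gt_eqF; last by rewrite mulr2n; lra.
have : 0 <= lebesgue_measure (A `&` ball x r) by [].
case: (lebesgue_measure _) => [c| |] //= _ _.
rewrite lte_fin ltr_pdivlMr; last by rewrite mulr2n; lra.
by rewrite mulr2n; lra.
Unshelve. all: by end_near. Qed.

(* Around density points of [A] and [B], intervals of the same small radius r
   have more than 3/4 of their length in [A], resp. [B]; superposing them up to
   an error r/2, these portions are too long to be disjoint. *)
Lemma shift_meets {R : realType} (A B : set R) :
  measurable A -> measurable B ->
  0 < lebesgue_measure A -> 0 < lebesgue_measure B ->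
  exists p q : R, (p < q)%R /\ forall t, (p < t < q)%R ->
    0 < lebesgue_measure (A `&` (fun x => x + t)%R @^-1` B).
Proof.
move=> mA mB A0 B0.
have [x Hx] := density_point A mA A0; have [y Hy] := density_point B mB B0.
near (0%R : R)^'+ => r.
have r0 : (0 < r)%R by [].
exists (y - x - r / 2)%R, (y - x + r / 2)%R; split; first by lra.
move=> t /andP[t1 t2].
pose U := A `&` ball x r.
pose V := (fun x => x + t)%R @^-1` (B `&` ball y r).
have mU : measurable (U : set (measurableTypeR R)).
  by apply: measurableI => //; exact: measurable_ball.
have mV : measurable (V : set (measurableTypeR R)).
  rewrite -[V]setTI; apply: measurable_shift => //.
  by apply: measurableI => //; exact: measurable_ball.
have Ul : ((3 / 2 * r)%R)%:E < lebesgue_measure U.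
  by rewrite /U; near: r; exact: Hx.
have Vl : ((3 / 2 * r)%R)%:E < lebesgue_measure V.
  by rewrite /V lebesgue_measure_shift; near: r; exact: Hy.
(* [V] lies in the ball of radius r around [y - t], a point less than r/2 away from [x]. *)
have UV : lebesgue_measure (U `|` V) <= ((3 * r)%R)%:E.
  apply: (@le_trans _ _ (lebesgue_measure (ball x (3 / 2 * r)%R))).
    apply: lebesgue_measure_le => z [[_]|[_]]; rewrite /ball/=.
      by move=> /lt_le_trans; apply; lra.
    by rewrite !ltr_norml => /andP[? ?]; apply/andP; split; lra.
  by rewrite lebesgue_measure_ball; [rewrite lee_fin mulr2n; lra|lra].
rewrite lt0e measure_ge0 andbT; apply/eqP => I0.
have I0' : lebesgue_measure (U `&` V) = 0.
  apply/eqP; rewrite -measure_le0 -[leRHS]I0.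
  by apply: lebesgue_measure_le => z [[? _] [? _]].
have Ufin : lebesgue_measure U < +oo.
  apply: le_lt_trans (ltry (3 * r)%R); apply: le_trans UV.
  by apply: lebesgue_measure_le => z; left.
(* If [U] and [V] met in a null set, their union would have measure greater than 3r/2 + 3r/2. *)
have := measureUfinl mU mV Ufin.
rewrite [X in _ = _ - X]I0' sube0 => E; move: UV; apply/negP; rewrite -ltNge.
rewrite [ltRHS]E (_ : 3 * r = 3 / 2 * r + 3 / 2 * r)%R; last by lra.
by rewrite EFinD lteD.
Unshelve. all: by end_near. Qed.

(** * The dense subgroup of the line generated by 1 and [sqrt 2] *)

Definition zsqrt2 {R : realType} (n : int * int) : R :=
  (n.1%:~R + n.2%:~R * Num.sqrt 2)%R.

Lemma zsqrt2D {R : realType} (m n : int * int) :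
  zsqrt2 (m + n)%R = (zsqrt2 m + zsqrt2 n)%R :> R.
Proof. by rewrite /zsqrt2 /= !intrD; ring. Qed.

Lemma zsqrt2_0 {R : realType} : zsqrt2 0%R = 0%R :> R.
Proof. by rewrite /zsqrt2 /= mul0r addr0. Qed.

Lemma zsqrt2N {R : realType} (n : int * int) :
  zsqrt2 (- n)%R = (- zsqrt2 n)%R :> R.
Proof. by rewrite /zsqrt2 /= !mulrNz; ring. Qed.

Lemma zsqrt2Mz {R : realType} (n : int * int) (k : int) :
  zsqrt2 (n *~ k)%R = (zsqrt2 n * k%:~R)%R :> R.
Proof.
rewrite /zsqrt2 (raddfMz fst) (raddfMz snd) !mulrzz !intrM; ring.
Qed.

(** This is the irrationality of [sqrt 2]: if a^2 = 2 b^2 with b nonzero, the exponent of 2 is even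
    on the left and odd on the right. *)
Lemma zsqrt2_eq0 {R : realType} (n : int * int) :
  (zsqrt2 n == 0%R :> R) = (n == 0%R).
Proof.
apply/idP/eqP => [|->]; last by rewrite zsqrt2_0.
case: n => a b; rewrite /zsqrt2 /= addr_eq0 => /eqP ab.
have : (a%:~R ^+ 2 = 2 * b%:~R ^+ 2 :> R)%R.
  by rewrite ab sqrrN exprMn sqr_sqrtr ?ler0n// mulrC.
rewrite -!rmorphXn/= -(intrM _ 2) => /eqP; rewrite eqr_int => /eqP {}ab.
have {ab} : (`|a| ^ 2 = 2 * `|b| ^ 2)%N by rewrite -!abszX ab abszM.
have [->|b0] := eqVneq b 0%R.
  by rewrite /= muln0 => /eqP; rewrite expn_eq0 andbT absz_eq0 => /eqP ->.
move=> /(congr1 (logn 2)); rewrite lognM ?expn_gt0 ?absz_gt0 ?b0//.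
by rewrite !lognX (logn_prime 2 (isT : prime 2)) /= => H; lia.
Qed.

(* The powers of [sqrt 2 - 1] are in the group and tend to 0. *)
Lemma zsqrt2_small {R : realType} (e : R) :
  (0 < e)%R -> exists n, (0 < (zsqrt2 n : R) < e)%R.
Proof.
move=> e0; pose s := Num.sqrt (2 : R).
have s2 : (s * s = 2)%R by rewrite -expr2 sqr_sqrtr.
have s0 : (0 <= s)%R by exact: sqrtr_ge0.
have s1 : (1 < s < 2)%R by nra.
have pow k : exists n, zsqrt2 n = ((s - 1) ^+ k)%R.
  elim: k => [|k [[a b] IH]].
    by exists (1, 0)%R; rewrite /zsqrt2 /= mul0r addr0.
  (* The coordinates of (a + b s)(s - 1), since s^2 = 2. *)
  exists (2 * b - a, a - b)%R; rewrite exprSr -IH /zsqrt2 /= -/s.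
  rewrite !intrB intrM; move: s2; set a' := a%:~R; set b' := b%:~R => s2.
  have -> : ((a' + b' * s) * (s - 1) = b' * (s * s) - a' + (a' - b') * s)%R.
    by ring.
  by rewrite s2; ring.
have [k _ Hk] : \forall k \near \oo, ((s - 1) ^+ k < e)%R.
  have : (fun k => (s - 1) ^+ k)%R @ \oo --> 0%R.
    by apply: cvg_expr; rewrite ger0_norm; lra.
  by move/cvgr_lt; exact.
have [n nk] := pow k; exists n; rewrite nk Hk/= ?andbT//.
by rewrite exprn_gt0//; lra.
Qed.

Lemma zsqrt2_dense {R : realType} (p q : R) :
  (p < q)%R -> exists n, (p < (zsqrt2 n : R) < q)%R.
Proof.
move=> pq; have [|n /andP[n0 nq]] := @zsqrt2_small R (q - p); first by rewrite subr_gt0.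
have /andP[f1 f2] := floor_itv (p / (zsqrt2 n : R)).
(* The first multiple of [zsqrt2 n] beyond [p]; it exceeds [p] by at most [zsqrt2 n], which is less
   than [q - p]. *)
exists (n *~ (Num.floor (p / (zsqrt2 n : R)) + 1))%R; rewrite zsqrt2Mz mulrC.
rewrite -ltr_pdivrMr// f2/= intrD mulrDl mul1r.
by move: f1; rewrite ler_pdivlMr//; lra.
Qed.

(** * The action by translations and its properties *)

Section translation_action.
Context {R : realType}.

Local Notation mu := (@completed_lebesgue_measure R).
Let T (n : int * int) (x : R) : R := (x + zsqrt2 n)%R.

Let preimageT n (A : set R) : T n @` A = T (- n)%R @^-1` A.
Proof.
rewrite /T; apply/seteqP; split => [_ [x Ax <-]|x Ax] /=.
  by rewrite zsqrt2N addrK.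
by exists (x + zsqrt2 (- n))%R => //; rewrite zsqrt2N subrK.
Qed.

Lemma completed_lebesgue_space : lebesgue_space mu.
Proof.
split; first exact: completed_lebesgue_measure_is_complete.
(* Nothing is discarded and there are no atoms: the space is the whole line. *)
exists set0, set0, `]-oo, +oo[%R, set0, idfun.
rewrite setU0 setC0 setD0 set_itvE; split.
- exact: negligible_set0.
- by split => //; exact: countable0.
- exact: negligible_set0.
- by split.
- move=> A _; rewrite image_id; split => //.
  by rewrite /lebesgue_measurable completed_caratheodory_measurable.
Qed.

Lemma translation_measure_preserving : measure_preserving_action mu T.
Proof.
split.
- by move=> x; rewrite /T zsqrt2_0 addr0.
- by move=> g h x; rewrite /T zsqrt2D addrCA addrC.
- by move=> g _ A mA; rewrite setTI; exact: caratheodory_shift.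
- by move=> g A mA; exact: lebesgue_measure_shift.
Qed.

Lemma translation_meets (A B : set R) :
  (wlength (@idfun R))^*%mu.-cara.-measurable A ->
  (wlength (@idfun R))^*%mu.-cara.-measurable B ->
  0 < mu A -> 0 < mu B -> exists n, n != 0%R /\ 0 < mu (A `&` T n @` B).
Proof.
move=> /caratheodory_sub_borel[A' [mA' A'A AA']].
move=> /caratheodory_sub_borel[B' [mB' B'B BB']] A0 B0.
have [p [q [pq H]]] :=
  shift_meets A' B' mA' mB' (lt_le_trans A0 AA') (lt_le_trans B0 BB').
(* The interval from [p] to [q] may contain 0; density is applied to a part of it on one side of 0,
   so that [n] is nonzero. *)
have [n [n0 nt]] : exists n, n != 0%R /\ (p < zsqrt2 n < q)%R.
  have [p0|p0] := ltP p 0%R.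
    have [|n /andP[np nq]] := zsqrt2_dense p (Num.min q 0%R).
      by rewrite lt_min pq.
    move: nq; rewrite lt_min => /andP[nq n0]; exists n; split; last by rewrite np.
    by rewrite -(@zsqrt2_eq0 R) lt_eqF.
  have [n /andP[np nq]] := zsqrt2_dense p q pq; exists n; split; last by rewrite np.
  by rewrite -(@zsqrt2_eq0 R) gt_eqF// (le_lt_trans p0).
exists (- n)%R; rewrite oppr_eq0 n0 preimageT opprK; split => //.
apply: lt_le_trans (H _ nt) _; apply: lebesgue_measure_le => x [xA xB].
by split; [exact: A'A|exact: B'B].
Qed.

Lemma translation_recurrent : recurrent mu T.
Proof. by move=> A mA A0; exact: translation_meets. Qed.

Lemma translation_ergodic : ergodic mu T.
Proof.
move=> A mA invA; have [|A0] := eqVneq (mu A) 0; [by left|right].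
apply/eqP; apply: contraT => CA0.
have [||||n [_]] := translation_meets A (~` A) => //.
- exact: measurableC.
- by rewrite lt0e A0 measure_ge0.
- by rewrite lt0e CA0 measure_ge0.
have nA : T (- n)%R @^-1` A = A by rewrite -preimageT; exact: invA.
(* The complement is invariant too, so its translate cannot meet [A]. *)
suff -> : T n @` (~` A) = ~` A by rewrite setICr measure0 ltxx.
by rewrite preimageT preimage_setC; congr (~` _).
Qed.

Lemma translation_line_not_recurrent (n : int * int) :
  n != 0%R -> ~ recurrent mu (fun k : int => T (n *~ k)%R).
Proof.
rewrite -(@zsqrt2_eq0 R) -normr_gt0; set t := zsqrt2 n => t0.
(* Two points of this ball are less than [|t|] apart, while for nonzero [k] the translation by
   [t * k] moves every point by at least [|t|]. *)
move=> /(_ (ball (0%R : R) (`|t| / 2)%R)) [||k [k0]].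
- by apply: sub_caratheodory; exact: measurable_ball.
- rewrite [ltRHS]lebesgue_measure_ball ?lte_fin; first by rewrite mulr2n; lra.
  by lra.
- rewrite [ltRHS](_ : _ = mu set0); first by rewrite measure0 ltxx.
  congr mu.
  rewrite -subset0 => x [].
  rewrite /ball/= sub0r normrN => x1 [y]; rewrite sub0r normrN => y1 /esym xy.
  have : (`|t * k%:~R| < `|t|)%R.
    have -> : (t * k%:~R = x - y)%R by rewrite xy /T zsqrt2Mz addrAC subrr add0r.
    by rewrite (le_lt_trans (ler_normB _ _))//; lra.
  rewrite normrM gtr_pMr// -intr_norm -[1%R]/(1%:~R)%R ltr_int; lia.
Qed.

End translation_action.

Theorem theorem1p1 (R : realType) :
  exists (d : measure_display) (X : measurableType d)
         (mu : {measure set X -> \bar R}) (T : (int * int)%type -> X -> X),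
    [/\ lebesgue_space mu, sigma_finite [set: X] mu & mu [set: X] = +oo] /\
    [/\ measure_preserving_action mu T, recurrent mu T & ergodic mu T] /\
    (forall n : (int * int)%type, n != 0%R ->
       ~ recurrent mu (fun k : int => T (n *~ k)%R)).
Proof.
exists _, _, (@completed_lebesgue_measure R), (fun n x => x + zsqrt2 n)%R.
split; first split.
- exact: completed_lebesgue_space.
- exact: sigma_finiteT.
- by have := @lebesgue_measure_itv R `]-oo, +oo[; rewrite set_itvE.
split; last exact: translation_line_not_recurrent.
split.
- exact: translation_measure_preserving.
- exact: translation_recurrent.
- exact: translation_ergodic.
Qed.
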